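(* Let $n\in\mathbb{N}$, $0<p<1$, and let $w:[0,\infty)\to\mathbb{R}$ be a solution to (P) with initial value $\alpha$, where $0<\alpha<(1-p)^{1/(1-p)}$. Then for any $\eta^*>0$ there exists $\eta\in[\eta^*,\infty)$ such that $w(\eta)=0$.
   Context: Let $H:\mathbb{R}\to\mathbb{R}$ be $H(w)=\frac{1}{1-p}w-w|w|^{p-1}$ for $w\neq0$, $H(0)=0$. For $\alpha\in[0,(1-p)^{1/(1-p)}]$, a solution to (P) with initial value $\alpha$ is a function $w\in C^2([0,\infty))\cap L^\infty([0,\infty))$ with $w(0)=\alpha$, $w'(0)=0$ and $$w''+\left(\frac{n-1}{\eta}+\frac{\eta}{2}\right)w'-H(w)=0\qquad\forall\,\eta\in(0,\infty).$$ *)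

(* Defs.v *)
From Stdlib Require Import Reals.
Open Scope R_scope.

(** Functions on [[0, +oo)] are represented by functions [R -> R] of which only
    the values on [halfline] matter; derivatives and continuity are relative to
    [halfline], hence one-sided at [0]. *)
Definition halfline (x : R) : Prop := 0 <= x.

Definition C2_halfline (w w' w'' : R -> R) : Prop :=
  forall x : R, 0 <= x ->
    D_in w w' halfline x /\ D_in w' w'' halfline x /\ continue_in w'' halfline x.

(** Lebesgue-null sets, through countable covers by open intervals. *)
Definition null_set (N : R -> Prop) : Prop :=
  forall eps : R, 0 < eps ->
    exists a b : nat -> R,
      (forall k : nat, a k <= b k) /\
      (forall x : R, N x -> exists k : nat, a k < x < b k) /\
      (forall m : nat, sum_f_R0 (fun k => b k - a k) m <= eps).

(** The measurability part of [L^oo] is omitted: the predicate is only used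
    for functions which are continuous on [halfline]. *)
Definition Linfty_halfline (w : R -> R) : Prop :=
  exists M : R, null_set (fun x => 0 <= x /\ M < Rabs (w x)).

Definition H (p w : R) : R :=
  if Req_EM_T w 0 then 0 else 1 / (1 - p) * w - w * Rpower (Rabs w) (p - 1).

Definition is_solution_P (n : nat) (p alpha : R) (w : R -> R) : Prop :=
  exists w' w'' : R -> R,
    C2_halfline w w' w'' /\
    Linfty_halfline w /\
    w 0 = alpha /\
    w' 0 = 0 /\
    forall eta : R, 0 < eta ->
      w'' eta + ((INR n - 1) / eta + eta / 2) * w' eta - H p (w eta) = 0.

(* Main.v *)
(** With [c = (1-p)^(1/(1-p))] and [alpha < beta < c], the energy
    [w'^2/2 - G(w)], [G] a primitive of [H], decreases along the solution and
    so confines [w] to [(-beta, beta)], where [H u <= - delta u^p] for [u > 0].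
    A solution that stayed positive from some point on could not keep
    increasing, since [w''] would stay below a negative constant; once it
    decreases, it satisfies [w' <= - kappa w^p / eta], so that
    [w^(1-p) + kappa (1-p) ln eta] is nonincreasing, which is impossible. The
    negative case follows because [H] is odd. *)
Require Import Defs.
From Stdlib Require Import Reals Lra.
From Coquelicot Require Import Coquelicot.
Open Scope R_scope.

(** * Monotonicity from the sign of the derivative *)

(** Mean value theorem. At [a] itself only continuity is asked, because the energy is to be compared
    with its value at [0], where the equation is singular. *)
Lemma nonincreasing_of_derive (f f' : R -> R) (a : R) :
  (forall x, a < x -> is_derive f x (f' x)) ->
  (forall x, a <= x -> continuity_pt f x) ->
  (forall x, a < x -> f' x <= 0) ->
  forall x y, a <= x -> x <= y -> f y <= f x.
Proof.
intros Hd Hc Hn x y Hax Hxy.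
destruct (Rle_lt_or_eq_dec _ _ Hxy) as [Hlt| ->]; [|lra].
assert (pr1 : forall c : R, x < c < y -> derivable_pt f c).
{ intros c Hcxy. exists (f' c). apply is_derive_Reals, Hd; lra. }
destruct (MVT f id x y pr1 (fun c _ => derivable_pt_id c) Hlt) as [c [P E]].
- intros c Hcxy. apply Hc; lra.
- intros c _. apply derivable_continuous_pt, derivable_pt_id.
- rewrite !Derive_Reals in E.
  rewrite Derive_id, (is_derive_unique f c (f' c)) in E by (apply Hd; lra).
  specialize (Hn c ltac:(lra)). unfold id in E. nra.
Qed.

Lemma nonincreasing_of_derive_closed (f f' : R -> R) (a : R) :
  (forall x, a <= x -> is_derive f x (f' x)) ->
  (forall x, a <= x -> f' x <= 0) ->
  forall x, a <= x -> f x <= f a.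
Proof.
intros Hd Hn x Hx.
apply (nonincreasing_of_derive f f' a); try lra.
- intros y Hy; apply Hd; lra.
- intros y Hy. apply derivable_continuous_pt. exists (f' y).
  apply is_derive_Reals, Hd; lra.
- intros y Hy; apply Hn; lra.
Qed.

(** * From the half-line to the real line *)

(** Increments smaller than [x] stay inside the half-line, so the relative derivative is two-sided
    there. *)
Lemma is_derive_of_D_in (f f' : R -> R) (x : R) :
  0 < x -> D_in f f' halfline x -> is_derive f x (f' x).
Proof.
intros Hx HD. apply is_derive_Reals. intros e He.
destruct (HD e He) as [d [Hd Hlim]].
assert (Hm : 0 < Rmin d x) by (apply Rmin_pos; lra).
exists (mkposreal _ Hm). intros h Hh0 Hh. simpl in Hh.
pose proof (Rmin_l d x). pose proof (Rmin_r d x).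
assert (Hh2 : - x < h) by (apply Rabs_def2 in Hh; lra).
specialize (Hlim (x + h)). simpl in Hlim. unfold Rdist in Hlim.
replace (x + h - x) with h in Hlim by ring.
apply Hlim. split; [split|]; unfold halfline; lra.
Qed.

(** The even extension makes available results that ask for two-sided continuity, such as the
    intermediate value theorem. *)
Lemma continuity_Rabs_extension (f : R -> R) :
  (forall x, 0 <= x -> continue_in f halfline x) ->
  continuity (fun x => f (Rabs x)).
Proof.
intros Hf x e He.
destruct (Hf (Rabs x) (Rabs_pos x) e He) as [d [Hd Hlim]].
exists d. split; [exact Hd|]. intros y [_ Hy]. simpl in *. unfold Rdist in *.
destruct (Req_dec (Rabs x) (Rabs y)) as [E|E].
- rewrite E, Rminus_diag, Rabs_R0. exact He.
- apply Hlim. split.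
  + split; [apply Rabs_pos|exact E].
  + eapply Rle_lt_trans; [apply Rabs_triang_inv2|exact Hy].
Qed.

Lemma is_derive_Rabs_extension (f f' : R -> R) (x : R) :
  0 < x -> is_derive f x (f' x) ->
  is_derive (fun x => f (Rabs x)) x (f' (Rabs x)).
Proof.
intros Hx HD. rewrite (Rabs_pos_eq x) by lra.
apply is_derive_ext_loc with f; [|exact HD].
exists (mkposreal x Hx). intros y Hy.
unfold ball in Hy; simpl in Hy; unfold AbsRing_ball, abs, minus, plus, opp in Hy; simpl in Hy.
apply Rabs_def2 in Hy. rewrite Rabs_pos_eq; lra.
Qed.

(** * The nonlinearity [H] *)

Lemma H_pos (p u : R) :
  0 < u -> H p u = u / (1 - p) - Rpower u p.
Proof.
intros Hu. unfold H. destruct (Req_EM_T u 0) as [E|_]; [lra|].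
rewrite Rabs_pos_eq by lra.
replace (Rpower u p) with (u * Rpower u (p - 1)).
- unfold Rdiv; ring.
- rewrite <- (Rpower_1 u) at 1 by lra. rewrite <- Rpower_plus. f_equal; ring.
Qed.

Lemma H_opp (p u : R) : H p (- u) = - H p u.
Proof.
unfold H. rewrite Rabs_Ropp.
destruct (Req_EM_T (- u) 0), (Req_EM_T u 0); try lra.
Qed.

(** Factoring [u = u^p u^(1-p)] gives [H u = - (1 - u^(1-p) / (1-p)) u^p], and [u^(1-p)] is at most
    [beta^(1-p)]. *)
Lemma H_le (p beta u : R) :
  p < 1 -> 0 < u <= beta ->
  H p u <= - (1 - Rpower beta (1 - p) / (1 - p)) * Rpower u p.
Proof.
intros Hp Hu. rewrite H_pos by lra.
assert (E : u = Rpower u p * Rpower u (1 - p)).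
{ rewrite <- Rpower_plus. replace (p + (1 - p)) with 1 by ring.
  symmetry; apply Rpower_1; lra. }
assert (Rpower u (1 - p) <= Rpower beta (1 - p)) by (apply Rle_Rpower_l; lra).
assert (0 < Rpower u p) by apply exp_pos.
assert (0 < / (1 - p)) by (apply Rinv_0_lt_compat; lra).
rewrite E at 1. unfold Rdiv.
assert (Rpower u p * (Rpower u (1 - p) * / (1 - p)) <=
        Rpower u p * (Rpower beta (1 - p) * / (1 - p))).
{ apply Rmult_le_compat_l; [lra|]. apply Rmult_le_compat_r; lra. }
nra.
Qed.

(** The upper bound [c] on [beta] is the positive zero of [H]: it satisfies [c^(1-p) = 1-p]. *)
Lemma decay_rate_pos (p beta : R) :
  p < 1 -> 0 < beta < Rpower (1 - p) (1 / (1 - p)) ->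
  0 < 1 - Rpower beta (1 - p) / (1 - p).
Proof.
intros Hp Hb.
assert (Rpower beta (1 - p) < 1 - p).
{ replace (1 - p) with (Rpower (Rpower (1 - p) (1 / (1 - p))) (1 - p)) at 2.
  - apply Rlt_Rpower_l; lra.
  - rewrite Rpower_mult. replace (1 / (1 - p) * (1 - p)) with 1 by (field; lra).
    apply Rpower_1; lra. }
assert (Rpower beta (1 - p) / (1 - p) < 1); [|lra].
apply Rmult_lt_reg_r with (1 - p); [lra|]. field_simplify; lra.
Qed.

Lemma H_neg (p beta u : R) :
  p < 1 -> beta < Rpower (1 - p) (1 / (1 - p)) -> 0 < u <= beta -> H p u < 0.
Proof.
intros Hp Hb Hu.
pose proof (H_le p beta u Hp Hu) as Hle.
pose proof (decay_rate_pos p beta Hp ltac:(lra)) as Hd.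
assert (Hpow : 0 < Rpower u p) by apply exp_pos.
pose proof (Rmult_lt_0_compat _ _ Hd Hpow). lra.
Qed.

Lemma continuous_H (p : R) : 0 < p < 1 -> forall x, continuous (H p) x.
Proof.
intros Hp x. destruct (Req_dec x 0) as [->|Hx].
- apply continuity_pt_filterlim. intros e He.
  assert (Hd1 : 0 < Rpower (e / 2) (1 / p)) by apply exp_pos.
  assert (Hd2 : 0 < e * (1 - p) / 2) by nra.
  (* The two radii make [u^p] and [u / (1-p)] each smaller than [e / 2]; negative arguments follow
     by oddness. *)
  exists (Rmin (Rpower (e / 2) (1 / p)) (e * (1 - p) / 2)).
  split; [apply Rmin_pos; assumption|].
  intros y [[_ Hy0] Hy]. simpl in *. unfold Rdist in *.
  assert (Hpos : forall u, 0 < u -> Rabs (u - 0) < Rmin (Rpower (e / 2) (1 / p)) (e * (1 - p) / 2) ->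
     Rabs (H p u) < e).
  { intros u Hu Hlt. rewrite Rminus_0_r, Rabs_pos_eq in Hlt by lra.
    pose proof (Rmin_l (Rpower (e / 2) (1 / p)) (e * (1 - p) / 2)).
    pose proof (Rmin_r (Rpower (e / 2) (1 / p)) (e * (1 - p) / 2)).
    rewrite H_pos by lra.
    assert (0 < Rpower u p) by apply exp_pos.
    assert (Rpower u p < e / 2).
    { replace (e / 2) with (Rpower (Rpower (e / 2) (1 / p)) p).
      - apply Rlt_Rpower_l; lra.
      - rewrite Rpower_mult. replace (1 / p * p) with 1 by (field; lra).
        apply Rpower_1; lra. }
    assert (0 < u / (1 - p)) by (apply Rdiv_lt_0_compat; lra).
    assert (u / (1 - p) < e / 2).
    { apply Rmult_lt_reg_r with (1 - p); [lra|]. field_simplify; lra. }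
    apply Rabs_def1; lra. }
  assert (H0 : H p 0 = 0) by (unfold H; destruct (Req_EM_T 0 0); lra).
  rewrite H0, Rminus_0_r.
  destruct (Rlt_or_le 0 y) as [Hyp|Hyn]; [apply Hpos; assumption|].
  rewrite <- Rabs_Ropp, <- H_opp. apply Hpos; [lra|].
  rewrite Rminus_0_r in *. rewrite Rabs_Ropp. exact Hy.
- apply continuous_ext_loc with (fun x => 1 / (1 - p) * x - x * Rpower (Rabs x) (p - 1)).
  + exists (mkposreal (Rabs x) (Rabs_pos_lt x Hx)). intros y Hy.
    unfold ball in Hy; simpl in Hy; unfold AbsRing_ball, abs, minus, plus, opp in Hy; simpl in Hy.
    unfold H. destruct (Req_EM_T y 0) as [->|_]; [|reflexivity].
    rewrite Rplus_0_l, Rabs_Ropp in Hy. lra.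
  + apply @ex_derive_continuous. unfold Rpower. auto_derive.
    repeat split; try assumption; apply Rabs_pos_lt; assumption.
Qed.

(** * Solutions cannot stay positive *)

(** Here [b] stands for [n - 1]. Only the equation beyond [x0] enters, with no initial condition, so
    that the lemma applies to [- w] as well. *)
Lemma no_positive_tail (p beta b x0 : R) (w w1 w2 : R -> R) :
  0 < p < 1 -> beta < Rpower (1 - p) (1 / (1 - p)) -> 0 <= b -> 0 < x0 ->
  (forall x, x0 <= x -> is_derive w x (w1 x)) ->
  (forall x, x0 <= x -> is_derive w1 x (w2 x)) ->
  (forall x, x0 <= x -> w2 x + (b / x + x / 2) * w1 x = H p (w x)) ->
  (forall x, x0 <= x -> 0 < w x <= beta) ->
  False.
Proof.
intros Hp Hbeta Hb Hx0 Hw Hw1 Hode Hpos.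
set (delta := 1 - Rpower beta (1 - p) / (1 - p)).
assert (Hdelta : 0 < delta).
{ apply decay_rate_pos; [lra|]. specialize (Hpos x0 ltac:(lra)). lra. }
assert (HH : forall x, x0 <= x -> H p (w x) <= - delta * Rpower (w x) p).
{ intros x Hx. apply H_le; [lra|auto]. }
assert (Hneg : exists x1, x0 <= x1 /\ w1 x1 < 0).
{ destruct (Classical_Prop.classic (exists x1, x0 <= x1 /\ w1 x1 < 0)) as [E|E]; [exact E|].
  exfalso.
  assert (Hw1pos : forall x, x0 <= x -> 0 <= w1 x).
  { intros x Hx. apply Rnot_lt_le. intros Hlt. apply E. exists x; auto. }
  assert (Hincr : forall x, x0 <= x -> w x0 <= w x).
  { intros x Hx.
    assert (- w x <= - w x0); [|lra].
    apply (nonincreasing_of_derive_closed (fun x => - w x) (fun x => - w1 x) x0); [| |exact Hx].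
    - intros y Hy. apply @is_derive_opp; auto.
    - intros y Hy. specialize (Hw1pos y Hy). lra. }
  set (m := delta * Rpower (w x0) p).
  assert (Hm : 0 < m) by (apply Rmult_lt_0_compat; [lra|apply exp_pos]).
  assert (Hlin : forall x, x0 <= x -> w1 x + m * x <= w1 x0 + m * x0).
  { apply (nonincreasing_of_derive_closed (fun x => w1 x + m * x) (fun x => w2 x + m)).
    - intros y Hy. apply @is_derive_plus; [auto|]. auto_derive; [exact I|ring].
    - intros y Hy. specialize (HH y Hy). specialize (Hode y Hy). specialize (Hw1pos y Hy).
      assert (0 <= b / y) by (apply Rdiv_le_0_compat; lra).
      assert (0 <= (b / y + y / 2) * w1 y) by (apply Rmult_le_pos; lra).
      assert (Rpower (w x0) p <= Rpower (w y) p).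
      { apply Rle_Rpower_l; [lra|]. split; [apply Hpos; lra|auto]. }
      assert (m <= delta * Rpower (w y) p) by (apply Rmult_le_compat_l; lra).
      lra. }
  assert (0 <= w1 x0 / m) by (apply Rdiv_le_0_compat; [apply Hw1pos|]; lra).
  (* At this point the linear bound [Hlin] forces [w1 <= - m]. *)
  specialize (Hlin (x0 + w1 x0 / m + 1) ltac:(lra)).
  specialize (Hw1pos (x0 + w1 x0 / m + 1) ltac:(lra)).
  replace (m * (x0 + w1 x0 / m + 1)) with (m * x0 + w1 x0 + m) in Hlin by (field; lra).
  lra. }
destruct Hneg as [x1 [Hx01 Hw1x1]].
(* The integrating factor [x^b exp (x^2/4)]: the equation becomes [(rho w')' = rho H(w)]. As
   [H(w) < 0], [rho w'] decreases, so [w'] stays negative from [x1] on. *)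
set (rho := fun x => exp (b * ln x + x * x / 4)).
assert (Hrho : forall x, 0 < x -> is_derive rho x ((b / x + x / 2) * rho x)).
{ intros x Hx. unfold rho. auto_derive; [exact Hx|].
  unfold Rdiv. field; lra. }
assert (Hrhopos : forall x, 0 < rho x) by (intros; apply exp_pos).
assert (Hw1neg : forall x, x1 <= x -> w1 x < 0).
{ intros x Hx.
  assert (Hle : rho x * w1 x <= rho x1 * w1 x1).
  { apply (nonincreasing_of_derive_closed (fun x => rho x * w1 x)
       (fun x => (b / x + x / 2) * rho x * w1 x + rho x * w2 x)); [| |exact Hx].
    - intros y Hy. apply @is_derive_mult; [apply Hrho; lra|apply Hw1; lra|].
      intros; apply Rmult_comm.
    - intros y Hy. replace (_ + _) with (rho y * H p (w y))
        by (rewrite <- Hode by lra; ring).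
      pose proof (H_neg p beta (w y) ltac:(lra) Hbeta (Hpos y ltac:(lra))).
      specialize (Hrhopos y). nra. }
  pose proof (Hrhopos x). pose proof (Hrhopos x1). nra. }
set (P := fun x => Rpower (w x) p).
assert (HP : forall x, 0 < P x) by (intros; apply exp_pos).
assert (HPd : forall x, x0 <= x -> is_derive P x (p * w1 x / w x * P x)).
{ intros x Hx. unfold P, Rpower. specialize (Hpos x Hx).
  auto_derive.
  - repeat split; [exists (w1 x); auto|lra].
  - replace (Derive _ x) with (w1 x) by (symmetry; apply is_derive_unique; auto).
    field; lra. }
(* For [x >= x1], [K] bounds the friction coefficient [b/x + x/2] divided by [x]. *)
set (K := b / (x1 * x1) + 1 / 2).
assert (HK : 0 < K).
{ assert (0 <= b / (x1 * x1)) by (apply Rdiv_le_0_compat; nra). unfold K; lra. }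
(* The first entry lets the term [- delta w^p] from [H] absorb the friction acting on
   [kappa w^p / x]; the second gives [w' + kappa w^p / x <= 0] at [x1]. *)
set (kappa := Rmin (delta / K) (- w1 x1 * x1 / P x1)).
assert (Hkappa : 0 < kappa).
{ apply Rmin_pos; apply Rdiv_lt_0_compat; auto; nra. }
assert (HkK : kappa * K <= delta).
{ pose proof (Rmin_l (delta / K) (- w1 x1 * x1 / P x1)) as Hm. fold kappa in Hm.
  apply Rmult_le_compat_r with (r := K) in Hm; [|lra].
  replace (delta / K * K) with delta in Hm by (field; lra). exact Hm. }
assert (Hkx1 : w1 x1 + kappa * (P x1 / x1) <= 0).
{ pose proof (Rmin_r (delta / K) (- w1 x1 * x1 / P x1)) as Hm. fold kappa in Hm.
  assert (0 < P x1 / x1) by (apply Rdiv_lt_0_compat; auto; lra).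
  apply Rmult_le_compat_r with (r := P x1 / x1) in Hm; [|lra].
  replace (- w1 x1 * x1 / P x1 * (P x1 / x1)) with (- w1 x1) in Hm
    by (field; split; [lra|]; specialize (HP x1); lra).
  lra. }
(* The choice of [kappa] makes [rho (w' + kappa w^p / x)] nonincreasing, and
   nonpositive at [x1]. *)
assert (Hslope : forall x, x1 <= x -> w1 x + kappa * (P x / x) <= 0).
{ intros x Hx.
  assert (Hle : rho x * (w1 x + kappa * (P x / x)) <= rho x1 * (w1 x1 + kappa * (P x1 / x1))).
  { apply (nonincreasing_of_derive_closed (fun x => rho x * (w1 x + kappa * (P x / x)))
       (fun x => (b / x + x / 2) * rho x * (w1 x + kappa * (P x / x)) +
                 rho x * (w2 x + kappa * ((p * w1 x / w x * P x * x - P x * 1) / x ^ 2))));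
      [| |exact Hx].
    - intros y Hy. apply (is_derive_mult rho (fun x => w1 x + kappa * (P x / x)));
        [apply Hrho; lra| |intros; apply Rmult_comm].
      apply (is_derive_plus w1); [apply Hw1; lra|].
      apply (is_derive_scal (fun x => P x / x)), is_derive_div; [apply HPd; lra| |lra].
      apply @is_derive_id.
    - intros y Hy. specialize (Hpos y ltac:(lra)). specialize (HP y).
      specialize (Hw1neg y Hy).
      (* After substituting the equation, the first two terms in the bracket sum to at most [0] by
         the choice of [kappa]; the third is negative because [w1 y < 0], and the fourth has a minus
         sign. *)
      replace (_ + _) with (rho y * (H p (w y) + kappa * (b / (y * y) + 1 / 2) * P y
          + kappa * (p * w1 y / w y / y) * P y - kappa * P y / (y * y)))
        by (rewrite <- Hode by lra; field; lra).
      specialize (HH y ltac:(lra)). fold (P y) in HH.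
      assert (b / (y * y) <= b / (x1 * x1)).
      { apply Rmult_le_compat_l; [lra|]. apply Rinv_le_contravar; nra. }
      assert (kappa * (b / (y * y) + 1 / 2) <= delta).
      { apply Rle_trans with (kappa * K); [|exact HkK].
        apply Rmult_le_compat_l; unfold K; lra. }
      assert (kappa * (b / (y * y) + 1 / 2) * P y <= delta * P y)
        by (apply Rmult_le_compat_r; lra).
      assert (0 < kappa * P y / (y * y))
        by (apply Rdiv_lt_0_compat; [apply Rmult_lt_0_compat; lra|nra]).
      assert (0 < kappa * (p * (- w1 y) / w y / y) * P y).
      { repeat apply Rmult_lt_0_compat; try lra; apply Rinv_0_lt_compat; lra. }
      replace (kappa * (p * - w1 y / w y / y) * P y) with
         (- (kappa * (p * w1 y / w y / y) * P y)) in * by (field; lra).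
      specialize (Hrhopos y). nra. }
  pose proof (Hrhopos x). pose proof (Hrhopos x1). nra. }
set (k := kappa * (1 - p)).
assert (Hk : 0 < k) by (apply Rmult_lt_0_compat; lra).
(* Separation of variables: [V' = (1-p) w' / w^p], which the slope bound makes at most [- k / x]. *)
set (V := fun x => Rpower (w x) (1 - p)).
assert (Hlog : forall x, x1 <= x -> V x + k * ln x <= V x1 + k * ln x1).
{ apply (nonincreasing_of_derive_closed (fun x => V x + k * ln x)
    (fun x => (1 - p) * w1 x / P x + k * / x)).
  - intros x Hx. unfold V, P. specialize (Hpos x ltac:(lra)).
    assert (E : / Rpower (w x) p = Rpower (w x) (1 - p) / w x).
    { replace (1 - p) with (1 + - p) by ring.
      rewrite Rpower_plus, Rpower_1, Rpower_Ropp by lra.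
      assert (0 < Rpower (w x) p) by apply exp_pos. field; lra. }
    unfold Rdiv. rewrite E. unfold Rpower. auto_derive.
    + repeat split; [exists (w1 x); apply Hw; lra|lra|lra].
    + replace (Derive _ x) with (w1 x)
        by (symmetry; apply is_derive_unique, Hw; lra).
      field; lra.
  - intros x Hx. specialize (Hslope x Hx). specialize (HP x). unfold k.
    replace (_ + _) with ((1 - p) / P x * (w1 x + kappa * (P x / x))) by (field; lra).
    assert (0 < (1 - p) / P x) by (apply Rdiv_lt_0_compat; lra). nra. }
assert (HV : forall x, 0 < V x) by (intros; apply exp_pos).
assert (HA : 0 < V x1 / k) by (apply Rdiv_lt_0_compat; auto).
assert (Hx1A : 0 < exp (V x1 / k)) by apply exp_pos.
assert (HexpA : 1 < exp (V x1 / k)) by (rewrite <- exp_0; apply exp_increasing; lra).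
(* Between [x1] and this point [k ln x] grows by exactly [V x1], so [Hlog] leaves [V <= 0], against
   the positivity of a power. *)
specialize (Hlog (x1 * exp (V x1 / k)) ltac:(nra)).
rewrite ln_mult, ln_exp in Hlog by lra.
replace (k * (ln x1 + V x1 / k)) with (k * ln x1 + V x1) in Hlog by (field; lra).
specialize (HV (x1 * exp (V x1 / k))). lra.
Qed.

(** * The equation in dimension zero *)

(* For [n = 0] the equation is [w'' - w'/x + (x/2) w' = H w]; as [w'(x)/x]
   tends to [w''(0)], the limit at [0] reads [0 = H alpha < 0]. *)
Lemma no_solution_dim0 (p alpha : R) (w w1 w2 : R -> R) :
  0 < p < 1 -> 0 < alpha < Rpower (1 - p) (1 / (1 - p)) ->
  C2_halfline w w1 w2 -> w 0 = alpha -> w1 0 = 0 ->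
  (forall x, 0 < x -> w2 x + ((0 - 1) / x + x / 2) * w1 x - H p (w x) = 0) ->
  False.
Proof.
intros Hp Ha HC Hw0 Hw10 Hode.
destruct (HC 0 (Rle_refl 0)) as [D1 [D2 C3]].
assert (HHa : H p alpha < 0) by (apply H_neg with alpha; lra).
pose proof (cont_deriv _ _ _ _ D1) as C1.
pose proof (cont_deriv _ _ _ _ D2) as C2.
unfold continue_in in *. unfold D_in in D2.
assert (CH : limit1_in (fun x => H p (w x)) (D_x halfline 0) (H p alpha) 0).
{ pose proof (continuous_H p Hp alpha) as Hc. apply continuity_pt_filterlim in Hc.
  rewrite Hw0 in C1. intros e He. destruct (Hc e He) as [d [Hd Hlim]].
  destruct (C1 d Hd) as [d' [Hd' Hlim']]. exists d'. split; [exact Hd'|].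
  intros x Hx. specialize (Hlim' x Hx). simpl in *.
  destruct (Req_dec alpha (w x)) as [E|E].
  - unfold Rdist. rewrite <- E, Rminus_diag, Rabs_R0. exact He.
  - apply Hlim. split; [split; [exact I|exact E]|exact Hlim']. }
assert (Cid : limit1_in (fun x => x) (D_x halfline 0) 0 0) by (apply lim_x).
(* [L1] says [x w'(x)] tends to [0]. In [L2] the values [w''(0)] of [w''] and of the difference
   quotient of [w'] cancel, so the quantity in [L3] tends to [- H alpha > 0]. *)
pose proof (limit_mul _ _ _ _ _ _ Cid C2) as L1.
pose proof (limit_minus _ _ _ _ _ _ C3 D2) as L2.
pose proof (limit_minus _ _ _ _ _ _ L2 CH) as L3.
rewrite Hw10 in L1, L3.
(* By the equation the quantity in [L3] is minus half the one in [L1]; with this tolerance on both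
   limits that is impossible. *)
assert (Hh : 0 < - H p alpha / 2) by lra.
destruct (L1 _ Hh) as [d1 [Hd1 B1]].
destruct (L3 _ Hh) as [d3 [Hd3 B3]].
pose proof (Rmin_pos d1 d3 Hd1 Hd3) as Hm.
pose proof (Rmin_l d1 d3) as Hl. pose proof (Rmin_r d1 d3) as Hr.
assert (exists x, 0 < x /\ x < d1 /\ x < d3) as [x [Hx [Hx1 Hx3]]]
  by (exists (Rmin d1 d3 / 2); lra).
simpl in B1, B3. unfold Rdist in B1, B3.
assert (HDx : D_x halfline 0 x) by (split; [unfold halfline|]; lra).
specialize (B1 x). specialize (B3 x).
rewrite !Rminus_0_r in B1, B3. rewrite (Rabs_pos_eq x) in B1, B3 by lra.
specialize (B1 (conj HDx Hx1)). specialize (B3 (conj HDx Hx3)).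
specialize (Hode x Hx).
rewrite Rmult_0_l, Rminus_0_r in B1.
apply Rabs_def2 in B1. apply Rabs_def2 in B3.
replace (w2 x + ((0 - 1) / x + x / 2) * w1 x - H p (w x)) with
  (w2 x - w1 x / x + x * w1 x / 2 - H p (w x)) in Hode by (field; lra).
lra.
Qed.

(** * Energy and confinement *)

(** An integral instead of a closed formula: differentiability, also at [0], then follows from the
    continuity of [H p]. *)
Definition potential (p x : R) : R := RInt (H p) 0 x.

Lemma is_derive_potential (p x : R) :
  0 < p < 1 -> is_derive (potential p) x (H p x).
Proof.
intros Hp. apply is_derive_RInt with 0; [|apply continuous_H, Hp].
apply filter_forall. intros y. apply @RInt_correct, @ex_RInt_continuous.
intros z _. apply continuous_H, Hp.
Qed.

(** Substitution of [- y] for [y], as [H p] is odd. *)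
Lemma potential_opp (p x : R) : 0 < p < 1 -> potential p (- x) = potential p x.
Proof.
intros Hp. unfold potential.
pose proof (RInt_comp_lin (H p) (-1) 0 0 x) as E.
replace (-1 * 0 + 0) with 0 in E by ring.
replace (-1 * x + 0) with (- x) in E by ring.
rewrite <- E by (apply @ex_RInt_continuous; intros z _; apply continuous_H, Hp).
apply RInt_ext. intros y _.
replace (-1 * y + 0) with (- y) by ring. rewrite H_opp.
unfold scal; simpl; unfold mult; simpl. ring.
Qed.

Lemma potential_decreasing (p a b : R) :
  0 < p < 1 -> 0 < a < b -> b < Rpower (1 - p) (1 / (1 - p)) ->
  potential p b < potential p a.
Proof.
intros Hp Hab Hb.
destruct (MVT_cor2 (potential p) (H p) a b) as [c [E Hc]]; [lra| |].
- intros c Hc. apply is_derive_Reals, is_derive_potential, Hp.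
- pose proof (H_neg p b c ltac:(lra) Hb ltac:(lra)). nra.
Qed.

(* The potential part of the energy at [+-beta] alone exceeds the initial
   energy, so [w] never reaches [+-beta]. *)
Lemma solution_trapped (p alpha beta b : R) (w w1 w2 : R -> R) :
  0 < p < 1 -> 0 < alpha < beta -> beta < Rpower (1 - p) (1 / (1 - p)) -> 0 <= b ->
  continuity w -> continuity w1 -> w 0 = alpha -> w1 0 = 0 ->
  (forall x, 0 < x -> is_derive w x (w1 x)) ->
  (forall x, 0 < x -> is_derive w1 x (w2 x)) ->
  (forall x, 0 < x -> w2 x + (b / x + x / 2) * w1 x = H p (w x)) ->
  forall x, 0 <= x -> Rabs (w x) < beta.
Proof.
intros Hp Hab Hb Hb0 Cw Cw1 Hw0 Hw10 Hw Hw1 Hode.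
set (En := fun x => w1 x * w1 x / 2 - potential p (w x)).
assert (HE : forall x, 0 <= x -> En x <= En 0).
{ intros x Hx.
  apply (nonincreasing_of_derive En (fun x => w1 x * w2 x - w1 x * H p (w x)) 0); try lra.
  - intros y Hy. unfold En. apply @is_derive_minus.
    + auto_derive; [repeat split; exists (w2 y); auto|].
      replace (Derive _ y) with (w2 y) by (symmetry; apply is_derive_unique; auto).
      field.
    + apply @is_derive_comp; [apply is_derive_potential, Hp|auto].
  - intros y _. unfold En. apply continuity_pt_minus.
    + unfold Rdiv. apply continuity_pt_mult; [apply continuity_pt_mult; apply Cw1|].
      apply continuity_pt_const. intros u v; reflexivity.
    + apply (continuity_pt_comp w (potential p)); [apply Cw|].
      apply derivable_continuous_pt. eexists.
      apply is_derive_Reals, is_derive_potential, Hp.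
  (* By the equation the energy has derivative [- (b/y + y/2) w'^2], nonpositive since [b >= 0]. *)
  - intros y Hy. rewrite <- Hode by exact Hy.
    assert (0 <= b / y) by (apply Rdiv_le_0_compat; lra).
    assert (0 <= (b / y + y / 2) * (w1 y * w1 y)) by (apply Rmult_le_pos; nra).
    lra. }
assert (Hpot : forall x, 0 <= x -> Rabs (w x) <> beta).
{ intros x Hx E. specialize (HE x Hx). unfold En in HE. rewrite Hw0, Hw10 in HE.
  pose proof (potential_decreasing p alpha beta Hp Hab Hb).
  assert (potential p (w x) = potential p beta).
  { rewrite <- E. unfold Rabs. destruct (Rcase_abs (w x)); [|reflexivity].
    symmetry; apply potential_opp, Hp. }
  nra. }
intros x Hx. apply Rnot_le_lt. intros Hge.
destruct (IVT_gen (fun x => Rabs (w x)) 0 x beta) as [z [Hz Ez]].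
- intros y. apply (continuity_pt_comp w Rabs); [apply Cw|apply Rcontinuity_abs].
- rewrite Hw0, (Rabs_pos_eq alpha) by lra. rewrite Rmin_left, Rmax_right; lra.
- rewrite Rmin_left in Hz by lra. exact (Hpot z ltac:(lra) Ez).
Qed.

(** * Zeros beyond every point *)

Theorem lemma4p6 (n : nat) (p alpha : R) (w : R -> R)
  (hp0 : 0 < p) (hp1 : p < 1)
  (halpha0 : 0 < alpha) (halpha1 : alpha < Rpower (1 - p) (1 / (1 - p)))
  (hw : is_solution_P n p alpha w) :
  forall eta_star : R, 0 < eta_star ->
    exists eta : R, eta_star <= eta /\ w eta = 0.
Proof.
intros x0 Hx0.
destruct hw as [w1 [w2 [HC [_ [Hw0 [Hw10 Hode]]]]]].
assert (Hp : 0 < p < 1) by lra.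
(* For [n = 0] the coefficient [n - 1] is negative and the friction has no fixed sign; that case is
   vacuous. *)
destruct n as [|n].
{ exfalso. apply (no_solution_dim0 p alpha w w1 w2); auto. }
set (b := INR (S n) - 1) in *.
assert (Hb : 0 <= b).
{ unfold b. rewrite S_INR. pose proof (pos_INR n). lra. }
assert (Hw : forall x, 0 < x -> is_derive w x (w1 x)).
{ intros x Hx. apply is_derive_of_D_in; [exact Hx|apply HC; lra]. }
assert (Hw1 : forall x, 0 < x -> is_derive w1 x (w2 x)).
{ intros x Hx. apply is_derive_of_D_in; [exact Hx|apply HC; lra]. }
assert (Cw : continuity (fun x => w (Rabs x))).
{ apply continuity_Rabs_extension. intros x Hx.
  apply (cont_deriv w w1), HC, Hx. }
assert (Cw1 : continuity (fun x => w1 (Rabs x))).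
{ apply continuity_Rabs_extension. intros x Hx.
  apply (cont_deriv w1 w2), HC, Hx. }
(* The midpoint is one choice of a level strictly between [alpha] and the positive zero of [H]. *)
set (beta := (alpha + Rpower (1 - p) (1 / (1 - p))) / 2).
assert (Htrap : forall x, 0 <= x -> Rabs (w x) < beta).
{ intros x Hx. rewrite <- (Rabs_pos_eq x Hx).
  apply (solution_trapped p alpha beta b (fun x => w (Rabs x)) (fun x => w1 (Rabs x))
    (fun x => w2 (Rabs x))); auto; try (unfold beta; lra); try (rewrite Rabs_R0; assumption).
  - intros y Hy. apply is_derive_Rabs_extension; auto.
  - intros y Hy. apply is_derive_Rabs_extension; auto.
  - intros y Hy. rewrite (Rabs_pos_eq y) by lra. specialize (Hode y Hy). lra. }
destruct (Classical_Prop.classic (exists x, x0 <= x /\ w x = 0)) as [E|E]; [exact E|exfalso].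
(* Without a zero beyond [x0], the intermediate value theorem fixes the sign of [w]; the product
   with [w x0] treats both signs at once. *)
assert (Hsign : forall x, x0 <= x -> 0 < w x0 * w x).
{ intros x Hx. apply Rnot_le_lt. intros Hle. apply E.
  destruct (IVT_gen (fun x => w (Rabs x)) x0 x 0 Cw) as [z [Hz Ez]].
  - rewrite !Rabs_pos_eq by lra.
    unfold Rmin, Rmax. destruct (Rle_dec (w x0) (w x)); split; nra.
  - rewrite Rmin_left in Hz by lra. exists z.
    rewrite Rabs_pos_eq in Ez by lra. split; [lra|exact Ez]. }
assert (Hbeta : beta < Rpower (1 - p) (1 / (1 - p))) by (unfold beta; lra).
destruct (Rlt_or_le 0 (w x0)) as [Hs|Hs].
- apply (no_positive_tail p beta b x0 w w1 w2); auto.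
  + intros x Hx; apply Hw; lra.
  + intros x Hx; apply Hw1; lra.
  + intros x Hx. specialize (Hode x ltac:(lra)). lra.
  + intros x Hx. specialize (Hsign x Hx). specialize (Htrap x ltac:(lra)).
    apply Rabs_def2 in Htrap. split; [nra|lra].
- apply (no_positive_tail p beta b x0 (fun x => - w x) (fun x => - w1 x) (fun x => - w2 x)); auto.
  + intros x Hx; apply @is_derive_opp, Hw; lra.
  + intros x Hx; apply @is_derive_opp, Hw1; lra.
  + intros x Hx. specialize (Hode x ltac:(lra)). rewrite H_opp. lra.
  + intros x Hx. specialize (Hsign x Hx). specialize (Htrap x ltac:(lra)).
    apply Rabs_def2 in Htrap. split; [nra|lra].
Qed.
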